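(* Let $A$ be a finite-dimensional simple left-symmetric algebra over $\mathbb{R}$ which either is a derivation algebra or satisfies $(x\cdot y)\cdot z=(y\cdot x)\cdot z$ for all $x,y,z\in A$. Then $A$ is isomorphic to either $A_{2,\mathbb{R}}$ or the field $\mathbb{R}$.
   Context: A left-symmetric algebra over $\mathbb{R}$ is a real vector space $A$ with a bilinear product $\cdot$ such that $(x\cdot y)\cdot z-x\cdot(y\cdot z)=(y\cdot x)\cdot z-y\cdot(x\cdot z)$ for all $x,y,z\in A$; it is a derivation algebra if moreover $(x\cdot y)\cdot z=(z\cdot y)\cdot x$ for all $x,y,z\in A$. An algebra $A$ is simple if it is nonzero, has no two-sided ideal other than $\{0\}$ and $A$, and is not the one-dimensional algebra with zero product. $A_{2,\mathbb{R}}$ is the two-dimensional commutative real algebra with basis $e_1,e_2$ and products $e_1\cdot e_1=e_1$, $e_1\cdot e_2=e_2\cdot e_1=e_2$, $e_2\cdot e_2=-e_1$. *)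

(* Defs.v *)
From HB Require Import structures.
From mathcomp Require Import all_boot all_order all_algebra.
From mathcomp Require Import reals.

Set Implicit Arguments.
Unset Strict Implicit.
Unset Printing Implicit Defensive.

Import Order.TTheory GRing.Theory Num.Theory.
Local Open Scope ring_scope.

(* A (non-associative) algebra is a vector space together with
   a product [mu]; bilinearity is required where the product is introduced. *)

Definition left_symmetric (V : zmodType) (mu : V -> V -> V) : Prop :=
  forall x y z : V,
    mu (mu x y) z - mu x (mu y z) = mu (mu y x) z - mu y (mu x z).

Definition derivation_algebra (V : zmodType) (mu : V -> V -> V) : Prop :=
  left_symmetric mu /\ forall x y z : V, mu (mu x y) z = mu (mu z y) x.

Definition two_sided_ideal (K : fieldType) (V : vectType K) (mu : V -> V -> V)
    (I : {vspace V}) : Prop :=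
  forall a x : V, x \in I -> mu a x \in I /\ mu x a \in I.

Definition simple_algebra (K : fieldType) (V : vectType K)
    (mu : V -> V -> V) : Prop :=
  [/\ {:V}%VS <> 0%VS,
      forall I : {vspace V},
        two_sided_ideal mu I -> I = 0%VS \/ I = {:V}%VS
    & ~ (\dim {:V} = 1%N /\ forall x y : V, mu x y = 0)].

Definition algebra_isomorphic (K : fieldType) (V W : lmodType K)
    (muV : V -> V -> V) (muW : W -> W -> W) : Prop :=
  exists f : {linear V -> W},
    bijective f /\ forall x y : V, f (muV x y) = muW (f x) (f y).

(* A_{2,R}: the basis vectors are indexed from 0, so that e_1, e_2 are
   [A2_basis 0] and [A2_basis 1]. *)
Definition A2_basis (K : fieldType) (i : 'I_2) : 'rV[K]_2 := delta_mx 0 i.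

Definition A2_table (K : fieldType) (i j : 'I_2) : 'rV[K]_2 :=
  if i == 0 then A2_basis K j
  else if j == 0 then A2_basis K i
  else - A2_basis K 0.

Definition A2_mul (K : fieldType) (x y : 'rV[K]_2) : 'rV[K]_2 :=
  \sum_(i < 2) \sum_(j < 2) (x 0 i * y 0 j) *: A2_table K i j.

Lemma A2_mul_basis (K : fieldType) (i j : 'I_2) :
  A2_mul (A2_basis K i) (A2_basis K j) = A2_table K i j.
Proof.
rewrite /A2_mul (bigD1 i) //= (bigD1 j) //= !big1 => [|k /negPf nk|k /negPf nk].
- by rewrite !addr0 !mxE !eqxx mulr1 scale1r.
- by rewrite big1 // => l _; rewrite !mxE eqxx nk mul0r scale0r.
- by rewrite !mxE !eqxx nk mulr0 scale0r.
Qed.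

Lemma A2_products (K : fieldType) (e1 := A2_basis K 0) (e2 := A2_basis K 1) :
  [/\ A2_mul e1 e1 = e1, A2_mul e1 e2 = e2, A2_mul e2 e1 = e2
    & A2_mul e2 e2 = - e1].
Proof. by rewrite /e1 /e2 !A2_mul_basis. Qed.

(* Main.v *)
Require Import Defs.
From HB Require Import structures.
From mathcomp Require Import all_boot all_order all_algebra.
From mathcomp Require Import reals boolp complex.

(* If (xy)z = (yx)z, then {n | nA = 0} is
   an ideal containing all commutators, so A is commutative.  For a derivation
   algebra the identity [a,b](cd + dc) = 0 makes J = {z | [A,A]z = 0} an ideal
   containing all cd + dc: J = 0 would make A anticommutative, which forces
   (AA)A = 0, so J = A, and [A,A] = 0 because only 0 annihilates A.
   Commutativity makes A associative as well, hence a finite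
   extension field of R. An eigenvalue a + ib of multiplication by z over the
   complex numbers gives (z - a)^2 = - b^2, so A is R or is spanned by 1 and a
   square root of -1. *)

Set Implicit Arguments.
Unset Strict Implicit.
Unset Printing Implicit Defensive.

Import Order.TTheory GRing.Theory Num.Theory.
Import passmx.
Local Open Scope ring_scope.

(** * Predicates closed under linear combinations, as subspaces *)

Definition linear_pred (K : fieldType) (V : vectType K) (P : V -> Prop) : Prop :=
  P 0 /\ forall (c : K) (x y : V), P x -> P y -> P (c *: x + y).

(** A subspace of maximal dimension inside [P] already contains any [x] with [P x]: adding the line
    through [x] stays inside [P]. *)
Lemma linear_pred_vspace (K : fieldType) (V : vectType K) (P : V -> Prop) :
  linear_pred P -> exists U : {vspace V}, forall x, x \in U <-> P x.
Proof.
case=> P0 Plin.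
pose dims : pred nat := fun d =>
  `[< exists2 U : {vspace V}, \dim U = d & forall x, x \in U -> P x >].
have ex_dim : exists d, dims d.
  exists 0%N; apply/asboolP; exists 0%VS; first exact: dimv0.
  by move=> x; rewrite memv0 => /eqP ->.
have bound_dim d : dims d -> (d <= \dim {:V})%N.
  by case/asboolP=> U <- _; exact/dimvS/subvf.
case: (ex_maxnP ex_dim bound_dim) => d /asboolP[U dimU UP] maxU.
exists U => x; split=> [|Px]; first exact: UP.
have : dims (\dim (<[x]> + U)%VS).
  apply/asboolP; exists (<[x]> + U)%VS => // y.
  case/memv_addP=> _ /vlineP[c ->] [u Uu ->].
  by apply: Plin => //; exact: UP.
move=> /maxU; rewrite -dimU => dim_le.
have /eqP eqU : U == (<[x]> + U)%VS by rewrite eqEdim addvSr.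
by rewrite eqU; apply: (subvP (addvSl _ _)); exact: memv_line.
Qed.

(** * Ideals and annihilators in a simple algebra *)

Section SimpleAlgebra.
Context (K : fieldType) (A : vectType K) (mu : {bilinear A -> A -> A}).
Context (hsimple : simple_algebra mu).
Local Notation "x ** y" := (mu x y) (at level 40, left associativity).

(** Under a zero product every line is an ideal, so the algebra would be one-dimensional, the
    excluded case. *)
Lemma simple_product_neq0 : ~ forall x y, x ** y = 0.
Proof.
case: hsimple => A0 hideal hdim mu0; apply: hdim; split=> //.
set x := vpick {:A}.
have [a z _|L0|<-] := hideal <[x]>%VS; first by rewrite !mu0 mem0v.
  by case: A0; apply/eqP; rewrite -vpick0 -/x -memv0 -L0 memv_line.
by rewrite dim_vline vpick0; case: eqP A0.
Qed.

Lemma simple_linear_ideal (P : A -> Prop) :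
    linear_pred P -> (forall a x, P x -> P (a ** x) /\ P (x ** a)) ->
  (forall x, P x -> x = 0) \/ (forall x, P x).
Proof.
case: hsimple => _ hideal _ /linear_pred_vspace[U UP] Pideal.
have [|U0|U1] := hideal U; [|left|right].
- move=> a x /UP /(Pideal a) [Pax Pxa]; split; exact/UP.
- by move=> x /UP; rewrite U0 memv0 => /eqP.
- by move=> x; apply/UP; rewrite U1 memvf.
Qed.

(** Such a [P] is an ideal because it contains every product, and it is nonzero because some product
    is. *)
Lemma simple_square_full (P : A -> Prop) :
  linear_pred P -> (forall x y, P (x ** y)) -> forall x, P x.
Proof.
move=> Plin Pmu; have [|P0|//] := simple_linear_ideal Plin.
  by move=> a x _; split.
by case: simple_product_neq0 => x y; exact: P0.
Qed.

Lemma linear_pred_lannihilator : linear_pred (fun x => forall y, x ** y = 0).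
Proof.
split=> [y|c x1 x2 x1P x2P y]; first by rewrite linear0l.
by rewrite linearPl x1P x2P scaler0 addr0.
Qed.

(** The left annihilator is stable under right multiplication, as [n ** a = 0]; the hypothesis
    supplies the other side, and a nonzero product keeps it from being everything. *)
Lemma lannihilator_ideal_eq0 :
    (forall n x, (forall y, n ** y = 0) -> forall y, (x ** n) ** y = 0) ->
  forall n, (forall y, n ** y = 0) -> n = 0.
Proof.
move=> hN; have [|//|mu0] := simple_linear_ideal linear_pred_lannihilator.
  by move=> a x xN; split=> // y; rewrite ?xN ?linear0l //; exact: hN.
by case: simple_product_neq0.
Qed.

Lemma left_Novikov_comm :
    (forall x y z, (x ** y) ** z = (y ** x) ** z) ->
  forall x y, x ** y = y ** x.
Proof.
move=> hsym x y; apply/eqP; rewrite -subr_eq0; apply/eqP.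
apply: lannihilator_ideal_eq0 => [n u nN z|z].
  by rewrite hsym nN linear0l.
by rewrite linearBl hsym subrr.
Qed.

(** * Commutativity of simple derivation algebras *)

Section Derivation.
Context (hls : left_symmetric mu).
Context (hinv : forall x y z, (x ** y) ** z = (z ** y) ** x).

(** Three exchanges of outer factors: (ab)(cd) = ((cd)b)a = ((bd)c)a = (ac)(bd). *)
Lemma medial a b c d : (a ** b) ** (c ** d) = (a ** c) ** (b ** d).
Proof. by rewrite hinv (hinv c d b) hinv. Qed.

(** Here [(u ** v) ** n = (n ** v) ** u = 0], and products span the algebra, so [x ** n = 0] for
    every [x]. *)
Lemma lannihilator_eq0 n : (forall y, n ** y = 0) -> n = 0.
Proof.
apply: lannihilator_ideal_eq0 => {}n x nN y.
suff -> : x ** n = 0 by rewrite linear0l.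
apply: (simple_square_full (P := fun x => x ** n = 0)) => [|u v].
  split=> [|c x1 x2 x1P x2P]; first by rewrite linear0l.
  by rewrite linearPl x1P x2P scaler0 addr0.
by rewrite hinv nN linear0l.
Qed.

Lemma left_symmetricE x y z :
  x ** (y ** z) = (x ** y) ** z - (y ** x) ** z + y ** (x ** z).
Proof.
have /eqP := hls x y z; rewrite subr_eq => /eqP ->.
by rewrite -addrA [- _ + _]addrC -(opprB ((y ** x) ** z)) addrC addKr.
Qed.

Lemma commutator_anticommutator a b c d :
  (a ** b) ** (c ** d) + (a ** b) ** (d ** c) =
  (b ** a) ** (c ** d) + (b ** a) ** (d ** c).
Proof.
(* T a b is symmetric term by term: twice by (xy)z = (zy)x, and for the
   associator by left symmetry. *)
pose T a b := ((a ** c) ** b) ** d + (b ** (d ** c)) ** a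
  + ((b ** a) ** c - b ** (a ** c)) ** d.
suff TE u v : (u ** v) ** (c ** d) + (u ** v) ** (d ** c) = T u v.
  rewrite !TE /T (hinv a c b) (hinv b (d ** c) a).
  by congr (_ + _ ** _); rewrite hls.
rewrite (hinv u v (d ** c)) (medial u v c d).
rewrite (left_symmetricE (u ** c) v d) (hinv u c d) -addrA.
(* Left symmetry for [d ** c], [v], [u], where [(d ** c) ** (v ** u)] equals
   [((v ** u) ** c) ** d]. *)
have -> : v ** ((d ** c) ** u) + ((d ** c) ** v) ** u
    = (v ** (d ** c)) ** u + ((v ** u) ** c) ** d.
  rewrite -(hinv d c (v ** u)) (left_symmetricE (d ** c) v u).
  by rewrite addrCA addrA subrK addrC.
rewrite /T linearBl -!addrA; congr (_ + _).
by rewrite addrCA [- _ + _]addrC.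
Qed.

Lemma derivation_comm (char2 : 2%:R != 0 :> K) x y : x ** y = y ** x.
Proof.
apply/eqP; rewrite -subr_eq0; apply/eqP.
pose J z := forall a b, (a ** b - b ** a) ** z = 0.
have Jlin : linear_pred J.
  split=> [a b|c z1 z2 z1J z2J a b]; first by rewrite linear0r.
  by rewrite linearPr z1J z2J scaler0 addr0.
have Janti c d : J (c ** d + d ** c).
  move=> a b; rewrite linearBl !linearDr commutator_anticommutator.
  by rewrite subrr.
have JL d z : J z -> J (d ** z).
  (* For a commutator w, left symmetry turns w(dz) into (wd - dw)z, again a commutator acting on
     [z]. *)
  move=> zJ a b; rewrite left_symmetricE zJ linear0r addr0 -linearBl.
  exact: zJ.
have [d z zJ|J0|Jall] := simple_linear_ideal Jlin.
- split; first exact: JL.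
  (* [z ** d] is the difference of [d ** z + z ** d] and [d ** z], both in [J]. *)
  move=> a b; have := Janti d z a b.
  by rewrite linearDr JL // add0r.
- have anti u v : u ** v = - (v ** u).
    by apply/eqP; rewrite -addr_eq0; apply/eqP/J0.
  have [] := simple_product_neq0.
  move=> u v; apply: lannihilator_eq0 => w.
  (* The triple product is symmetric under (1 3) and antisymmetric under
     (1 2), which are conjugate. *)
  have /eqP : (u ** v) ** w = - ((u ** v) ** w).
    rewrite {1}hinv [w ** v]anti linearNl hinv [u ** w]anti linearNl opprK.
    by rewrite hinv [v ** u]anti linearNl.
  by rewrite -addr_eq0 -mulr2n -scaler_nat scaler_eq0 (negPf char2) => /eqP.
- by apply: lannihilator_eq0 => z; exact: Jall.
Qed.

End Derivation.

(** * Simple commutative associative algebras are fields *)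

Section CommutativeAssociative.
Context (mulC : forall x y, x ** y = y ** x).
Context (mulA : forall x y z, x ** (y ** z) = (x ** y) ** z).

(** The multiples of [x] form an ideal; were it zero, [x] would annihilate the algebra and
    vanish. *)
Lemma simple_comm_assoc_div x : x != 0 -> forall z, exists w, z = x ** w.
Proof.
move=> x0.
have [||P0|//] := simple_linear_ideal (P := fun z => exists w, z = x ** w).
- split=> [|c _ _ [u ->] [v ->]]; first by exists 0; rewrite linear0r.
  by exists (c *: u + v); rewrite linearPr.
- move=> a _ [w ->]; split; last by exists (w ** a); rewrite mulA.
  by exists (w ** a); rewrite mulC -mulA.
suff /eqP : x = 0 by rewrite (negPf x0).
apply: lannihilator_ideal_eq0 => [n y nN z|y]; last by apply: P0; exists y.
by rewrite -mulA nN linear0r.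
Qed.

(** Solve x = xe for one nonzero x; any z is some xw, so ez = (ex)w = z. *)
Lemma simple_comm_assoc_unit : exists2 e, e != 0 & forall x, e ** x = x.
Proof.
have x0 : vpick {:A} != 0 by rewrite vpick0; case: hsimple => /eqP.
have [e xe] := simple_comm_assoc_div x0 (vpick {:A}).
exists e => [|z]; first by apply: contraNneq x0 => e0; rewrite xe e0 linear0r.
by have [w ->] := simple_comm_assoc_div x0 z; rewrite mulA [e ** _]mulC -xe.
Qed.

Lemma simple_comm_assoc_integral x y : x ** y = 0 -> x = 0 \/ y = 0.
Proof.
move=> xy0; have [->|x0] := eqVneq x 0; [by left|right].
have [e _ e1] := simple_comm_assoc_unit.
have [w ew] := simple_comm_assoc_div x0 e.
by rewrite -[y]e1 ew [x ** w]mulC -mulA xy0 linear0r.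
Qed.

End CommutativeAssociative.
End SimpleAlgebra.

(** * Real vectors from complex eigenvalues *)

Lemma real_matrix_quadratic_vector (R : rcfType) (n : nat) (M : 'M[R]_n) :
    (0 < n)%N ->
  exists a b, exists2 u : 'rV_n, u != 0 &
    u *m (M - a%:M) *m (M - a%:M) = - b ^+ 2 *: u.
Proof.
move=> n_gt0; pose Mc := map_mx (real_complex R) M.
have [|[a b]] := @closed_rootP R[i] (char_poly Mc) _.
  by rewrite size_char_poly eqSS -lt0n.
rewrite -eigenvalue_root_char => /eigenvalueP[v vM v0].
pose N := (M - a%:M) *m (M - a%:M) + (b ^+ 2)%:M.
have vMa : v *m (Mc - (real_complex R a)%:M) = (Complex 0 b) *: v.
  by rewrite mulmxBr vM mul_mx_scalar -scalerBl; congr (_ *: _); simpc.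
(* The complex eigenvector [v] is killed by [N], since (ib)^2 + b^2 = 0. The determinant of [N] is
   computed over [R], so its vanishing also yields a nonzero real kernel vector. *)
have /eqP : \det N = 0.
  apply: (fmorph_inj (real_complex R)); rewrite -det_map_mx rmorph0.
  apply/eqP/det0P; exists v => //.
  rewrite map_mxD map_mxM map_mxB !map_scalar_mx mulmxDr mulmxA vMa -scalemxAl.
  rewrite vMa scalerA mul_mx_scalar -scalerDl.
  rewrite [X in X *: _](_ : _ = 0) ?scale0r //.
  by simpc; rewrite expr2 addNr.
case/det0P=> u u0 uN; exists a, b, u => //; apply/eqP.
by rewrite -mulmxA scaleNr -addr_eq0 -mul_mx_scalar -mulmxDr; apply/eqP.
Qed.

Lemma real_endomorphism_quadratic_vector (R : rcfType) (V : vectType R)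
    (f : 'End(V)) :
    {:V}%VS <> 0%VS ->
  exists a b, exists2 x, x != 0 &
    f (f x - a *: x) - a *: (f x - a *: x) = - b ^+ 2 *: x.
Proof.
move=> /eqP V0; have eP := vbasisP {:V}; set e := vbasis {:V} in eP.
have [|a [b [u u0 uM]]] := @real_matrix_quadratic_vector R _ (mxof e e f).
  by rewrite lt0n dimv_eq0.
have step w :
    vecof e (w *m (mxof e e f - a%:M)) = f (vecof e w) - a *: vecof e w.
  by rewrite mulmxBr mul_mx_scalar linearB linearZ /= (hom_vecof e eP).
exists a, b, (vecof e u); first by rewrite vecof_eq0.
by rewrite -!step uM linearZ.
Qed.

(** * The field case over a real closed field *)

Section Real.
Context (R : rcfType) (A : vectType R) (mu : {bilinear A -> A -> A}).
Context (hsimple : simple_algebra mu).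
Local Notation "x ** y" := (mu x y) (at level 40, left associativity).
Context (mulC : forall x y, x ** y = y ** x).
Context (mulA : forall x y z, x ** (y ** z) = (x ** y) ** z).
Context (e : A) (mul1 : forall x, e ** x = x).

(** The relation for multiplication by [z] holds at a single [x != 0]; as there are no zero
    divisors, [x] cancels. *)
Lemma simple_comm_assoc_quadratic z :
  exists a b, (z - a *: e) ** (z - a *: e) = - b ^+ 2 *: e.
Proof.
have [A0 _ _] := hsimple.
have [a [b [x x0]]] := real_endomorphism_quadratic_vector (linfun (mu z)) A0.
rewrite !lfunE /= => fx.
exists a, b; apply/eqP; rewrite -subr_eq0; apply/eqP.
set t := z - a *: e in fx *.
have tE w : t ** w = z ** w - a *: w by rewrite linearBl linearZl_LR mul1.
have : (t ** t - - b ^+ 2 *: e) ** x = 0.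
  by rewrite linearBl linearZl_LR mul1 -mulA !tE fx subrr.
case/(simple_comm_assoc_integral hsimple mulC mulA) => // /eqP.
by rewrite (negPf x0).
Qed.

Lemma simple_comm_assoc_real_or_complex :
  (forall z, exists a, z = a *: e) \/
  exists2 j, j ** j = - e & forall z, exists a b, z = a *: e + b *: j.
Proof.
have [hR|/existsNP[y yR]] := pselect (forall z, exists a, z = a *: e).
  by left.
have sqr0 x : x ** x = 0 -> x = 0.
  by case/(simple_comm_assoc_integral hsimple mulC mulA).
right; have [a [b yE]] := simple_comm_assoc_quadratic y.
(* If [b] were 0, then [y - a *: e] would have square zero, hence vanish. *)
have b0 : b != 0.
  apply/eqP => b0; apply: yR; exists a.
  apply/eqP; rewrite -subr_eq0; apply/eqP/sqr0.
  by rewrite yE b0 expr0n oppr0 scale0r.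
pose j := b^-1 *: (y - a *: e).
have jj : j ** j = - e.
  rewrite /j linearZl_LR linearZr_LR yE !scalerA -scaleN1r; congr (_ *: _).
  by rewrite mulrN -expr2 exprVn mulVf // expf_neq0.
move: j jj => j jj.
exists j => // z; have [c [d zE]] := simple_comm_assoc_quadratic z.
have : z = c *: e + (z - c *: e) by rewrite addrC subrK.
move: (z - c *: e) zE => t tt ->.
(* [t] and [d *: j] have the same square, so the difference of squares factors. *)
have : (t - d *: j) ** (t + d *: j) = 0.
  rewrite linearBl !linearDr tt !linearZl_LR !linearZr_LR jj (mulC j t).
  by rewrite opprD addrA addrK scalerA scalerN opprK -expr2 scaleNr addNr.
case/(simple_comm_assoc_integral hsimple mulC mulA) => /eqP.
  by rewrite subr_eq0 => /eqP ->; exists c, d.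
by rewrite addr_eq0 => /eqP ->; exists c, (- d); rewrite scaleNr.
Qed.

End Real.

(** * Isomorphisms with the two models *)

Lemma algebra_isomorphic_sym (K : fieldType) (V W : vectType K)
    (muV : V -> V -> V) (muW : W -> W -> W) :
  algebra_isomorphic muW muV -> algebra_isomorphic muV muW.
Proof.
case=> f [[g fK gK] fM].
pose gL := GRing.isLinear.Build K V W *:%R g (can2_linear fK gK).
pose gl : {linear V -> W} := HB.pack g gL.
exists gl; split=> [|x y]; first by exists f.
by apply: (can_inj fK); rewrite fM /= !gK.
Qed.

Lemma inj_surj_isomorphic (K : fieldType) (V W : vectType K)
    (muV : V -> V -> V) (muW : W -> W -> W) (f : {linear V -> W}) :
    (forall x, f x = 0 -> x = 0) -> (forall y, exists x, y = f x) ->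
    (forall x y, f (muV x y) = muW (f x) (f y)) ->
  algebra_isomorphic muV muW.
Proof.
move=> f_inj f_surj fM; exists f; split=> //.
have [g gK] := choice f_surj; exists g => y; last by rewrite -gK.
apply/eqP; rewrite -subr_eq0; apply/eqP/f_inj.
by rewrite linearB -gK subrr.
Qed.

Lemma ord2_cases (i : 'I_2) : i = 0 \/ i = 1.
Proof. by case: i => [[|[|//]] ?]; [left|right]; exact/val_inj. Qed.

(** This is complex multiplication, the row (p, q) standing for p + iq. *)
Lemma A2_mulE (K : fieldType) (u v : 'rV[K]_2) :
  A2_mul u v = \row_i (if i == 0 then u 0 0 * v 0 0 - u 0 1 * v 0 1
                       else u 0 0 * v 0 1 + u 0 1 * v 0 0).
Proof.
apply/rowP => i; rewrite /A2_mul !big_ord_recl !big_ord0.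
rewrite /A2_table /A2_basis !addr0 !mxE /=.
rewrite (_ : lift 0 0 = 1); last exact/val_inj.
by case: (ord2_cases i) => -> /=;
  rewrite !(mulr0, mulr1, mulrN, oppr0, addr0, add0r).
Qed.

Theorem proposition35 (R : realType) (A : vectType R)
    (mu : {bilinear A -> A -> A})
    (hls : left_symmetric mu)
    (hsimple : simple_algebra mu)
    (hcase : derivation_algebra mu \/
       forall x y z : A, mu (mu x y) z = mu (mu y x) z) :
  algebra_isomorphic mu (@A2_mul R) \/
  algebra_isomorphic mu (fun x y : R^o => x * y).
Proof.
have [mulC mulA] : (forall x y, mu x y = mu y x) /\
    (forall x y z, mu x (mu y z) = mu (mu x y) z).
  case: hcase => [[_ hinv]|hNov].
    have two0 : 2%:R != 0 :> R by rewrite pnatr_eq0.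
    have mulC := derivation_comm hsimple hls hinv two0.
    by split=> // x y z; rewrite hinv [mu z y]mulC mulC.
  have mulC := left_Novikov_comm hsimple hNov.
  (* Left symmetry gives x(zy) = (xz)y - (zx)y + z(xy), where the first two terms cancel. *)
  split=> // x y z; rewrite [mu y z]mulC (left_symmetricE hls) (hNov x z).
  by rewrite subrr add0r mulC.
have [e e0 mul1] := simple_comm_assoc_unit hsimple mulC mulA.
have mul1r x : mu x e = x by rewrite mulC.
case: (simple_comm_assoc_real_or_complex hsimple mulC mulA mul1).
  move=> eR; right; apply: algebra_isomorphic_sym.
  pose f (t : R^o) := t *: e.
  have f_lin : linear f by move=> c s t; rewrite /f scalerDl scalerA.
  pose fl : {linear R^o -> A} :=
    HB.pack f (GRing.isLinear.Build R R^o A *:%R f f_lin).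
  apply: (@inj_surj_isomorphic _ R^o A _ _ fl) => [x /= /eqP|//|x y /=].
    by rewrite scaler_eq0 (negPf e0) orbF => /eqP.
  by rewrite /f linearZl_LR mul1 scalerA.
case=> j jj ejR; left; apply: algebra_isomorphic_sym.
pose f (v : 'rV[R]_2) := v 0 0 *: e + v 0 1 *: j.
have f_lin : linear f.
  move=> c u v; rewrite /f !mxE !scalerDl !scalerDr !scalerA.
  by rewrite addrACA.
pose fl : {linear 'rV[R]_2 -> A} :=
  HB.pack f (GRing.isLinear.Build R 'rV[R]_2 A *:%R f f_lin).
apply: (@inj_surj_isomorphic _ 'rV[R]_2 A _ _ fl) => [v|z|u v] /=.
(* Injectivity: multiplying pe + qj = 0 by its conjugate pe - qj gives (p^2 + q^2)e = 0. *)
- move=> v0; have : (v 0 0 ^+ 2 + v 0 1 ^+ 2) *: e = 0.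
    rewrite -(linear0l mu (v 0 0 *: e - v 0 1 *: j)) -v0 /f.
    rewrite linearBr !linearDl !linearZl_LR !linearZr_LR jj mul1 mul1 mul1r.
    rewrite opprD addrA !scalerN opprK !scalerA [v 0 1 * v 0 0]mulrC addrK.
    by rewrite -scalerDl !expr2.
  move/eqP; rewrite scaler_eq0 (negPf e0) orbF paddr_eq0 ?sqr_ge0 // !sqrf_eq0.
  case/andP=> /eqP v00 /eqP v01; apply/rowP=> i; rewrite mxE.
  by case: (ord2_cases i) => ->.
- have [a [b ->]] := ejR z; exists (\row_i (if i == 0 then a else b)).
  by rewrite /f !mxE.
- rewrite /f A2_mulE !mxE /=.
  rewrite linearDl !linearDr !linearZl_LR !linearZr_LR jj !mul1 mul1r !scalerA.
  by rewrite scalerBl scalerDl scalerN addrACA -!addrA; congr (_ + _);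
    rewrite addrCA addrC -!addrA.
Qed.
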